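(* Let $X$ be a nontrivial real Banach space and $\mathcal{U}$ a free ultrafilter on $\mathbb{N}$. Then the following assertions are equivalent: (i) $X$ is octahedral. (ii) For all $n\in\mathbb{N}$ and all $z_1,\dots,z_n\in S_{X^{\mathcal{U}}}$ there exists an element $z\in S_{X^{\mathcal{U}}}$ such that $\|z_i+z\|_{\mathcal{U}}=2$ for every $i\in\{1,\dots,n\}$. (iii) $X^{\mathcal{U}}$ is octahedral. Likewise, the following statements are equivalent: (i') $X$ is locally octahedral. (ii') For every $z\in S_{X^{\mathcal{U}}}$ there is some $\tilde z\in S_{X^{\mathcal{U}}}$ such that $\|z+\tilde z\|_{\mathcal{U}}=\|z-\tilde z\|_{\mathcal{U}}=2$. (iii') $X^{\mathcal{U}}$ is locally octahedral.
   Context: All Banach spaces are real; nontrivial means $\neq\{0\}$. $S_X$ is the unit sphere of $X$. $X$ is octahedral if for every finite-dimensional subspace $E$ of $X$ and every $\varepsilon>0$ there is some $y\in S_X$ such that $\|x+y\|\geq(1-\varepsilon)(\|x\|+1)$ for all $x\in E$. $X$ is locally octahedral if for every $x\in X$ and every $\varepsilon>0$ there exists $y\in S_X$ such that $\|sx+y\|\geq(1-\varepsilon)(|s|\,\|x\|+1)$ for all $s\in\mathbb{R}$. For a free ultrafilter $\mathcal{U}$ on $\mathbb{N}$ and a bounded real sequence $(a_n)$, $\lim_{n,\mathcal{U}}a_n$ is the unique $a\in\mathbb{R}$ such that $\{n\in\mathbb{N}:|a_n-a|<\varepsilon\}\in\mathcal{U}$ for every $\varepsilon>0$. Let $\ell^\infty(X)$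 be the space of all bounded sequences in $X$ and $\mathcal{N}_{\mathcal{U}}:=\{(x_n)\in\ell^\infty(X):\lim_{n,\mathcal{U}}\|x_n\|=0\}$. The ultrapower $X^{\mathcal{U}}$ is the quotient $\ell^\infty(X)/\mathcal{N}_{\mathcal{U}}$ with the norm $\|[(x_n)]\|_{\mathcal{U}}:=\lim_{n,\mathcal{U}}\|x_n\|$; it is a Banach space. *)

(* Defs.v *)
From HB Require Import structures.
From mathcomp Require Import all_boot all_order all_algebra ring_quotient.
From mathcomp Require Import all_classical all_reals all_analysis.

Set Implicit Arguments.
Unset Strict Implicit.
Unset Printing Implicit Defensive.

Import Order.TTheory GRing.Theory Num.Theory.
Import numFieldNormedType.Exports.

Local Open Scope classical_set_scope.
Local Open Scope ring_scope.
Local Open Scope quotient_scope.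

Definition unit_sphere (R : realType) (X : normedModType R) : set X :=
  [set x | `|x| = 1].
Arguments unit_sphere {R} X.

Definition findim_subspace (R : realType) (X : normedModType R) (E : set X) :=
  exists (k : nat) (b : 'I_k -> X),
    E = [set x | exists c : 'I_k -> R, x = \sum_i c i *: b i].

Definition octahedral (R : realType) (X : normedModType R) : Prop :=
  forall (E : set X) (e : R), findim_subspace E -> 0 < e ->
    exists2 y, unit_sphere X y &
      forall x, E x -> (1 - e) * (`|x| + 1) <= `|x + y|.

Definition locally_octahedral (R : realType) (X : normedModType R) : Prop :=
  forall (x : X) (e : R), 0 < e ->
    exists2 y, unit_sphere X y &
      forall s : R, (1 - e) * (`|s| * `|x| + 1) <= `|s *: x + y|.

Definition free_filter (U : set_system nat) : Prop :=
  \bigcap_(A in U) A = set0.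

Section ellinfty.
Context (R : realType) (X : normedModType R).

Definition ellinfty_pred : {pred nat -> X} :=
  fun x => `[< bounded_fun x >].

Lemma ellinfty_predP (x : nat -> X) :
  reflect (exists M, forall n, `|x n| <= M) (x \in ellinfty_pred).
Proof.
apply: (iffP (asboolP _)) => [[M [Mreal bM]]|[M bM]].
  by exists (M + 1) => n; apply: bM => //; rewrite ltrDl.
exists M; split; first exact: num_real.
by move=> y /ltW My n _; exact: le_trans (bM n) My.
Qed.

Lemma ellinfty_submod_closed : submod_closed ellinfty_pred.
Proof.
split; first by apply/ellinfty_predP; exists 0 => n; rewrite normr0.
move=> a x y /ellinfty_predP[M xM] /ellinfty_predP[N yN].
apply/ellinfty_predP; exists (`|a| * M + N) => n.
rewrite (le_trans (ler_normD _ _))// lerD//.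
by rewrite normrZ ler_wpM2l.
Qed.

HB.instance Definition _ :=
  GRing.isSubmodClosed.Build R (nat -> X) ellinfty_pred ellinfty_submod_closed.

Definition ellinfty := {x : nat -> X | x \in ellinfty_pred}.

HB.instance Definition _ := SubChoice.on ellinfty.
HB.instance Definition _ := [SubChoice_isSubLmodule of ellinfty by <:].

End ellinfty.

Section ultrapower.
Context (R : realType) (X : normedModType R).
Context (U : set_system nat) (UU : UltraFilter U).

Implicit Types x y : ellinfty X.

Definition ulim_norm x : R := lim ((fun n => `|val x n|) @ U).

Lemma ulim_normP x : (fun n => `|val x n|) @ U --> ulim_norm x.
Proof.
have [M xM] := elimT (ellinfty_predP (val x)) (valP x).
have : ((fun n => `|val x n|) @ U) `[0, M]%classic.
  by apply: nearW => n; rewrite /= in_itv/= normr_ge0 xM.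
move=> /(@segment_compact R 0 M _ _)[l [_ cl]].
suff xl : (fun n => `|val x n|) @ U --> l by apply/cvg_ex; exists l.
move=> V Vl; rewrite /= nbhs_filterE.
have [//|UnV] := in_ultra_setVsetC ((fun n => `|val x n|) @^-1` V) UU.
by have [r [nVr Vr]] := cl (~` V) V UnV Vl.
Qed.

Lemma ulim_normE x (l : R) :
  (fun n => `|val x n|) @ U --> l -> ulim_norm x = l.
Proof. exact: cvg_lim. Qed.

Lemma ulim_norm_ge0 x : 0 <= ulim_norm x.
Proof.
apply: (ler_cvg_to (cvg_cst 0) (@ulim_normP x)).
by apply: nearW => n; exact: normr_ge0.
Qed.

Lemma ulim_normD x y : ulim_norm (x + y) <= ulim_norm x + ulim_norm y.
Proof.
apply: (ler_cvg_to (@ulim_normP (x + y)) (cvgD (@ulim_normP x) (@ulim_normP y))).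
by apply: nearW => n; rewrite raddfD; exact: ler_normD.
Qed.

Lemma ulim_normZ (a : R) x : ulim_norm (a *: x) = `|a| * ulim_norm x.
Proof.
apply: ulim_normE.
have -> : (fun n => `|val (a *: x) n|) = (fun n => `|a| * `|val x n|).
  by apply/funext => n; rewrite linearZ /= normrZ.
exact: cvgMr (@ulim_normP x).
Qed.

Lemma ulim_norm0 : ulim_norm 0 = 0.
Proof. by rewrite -(scale0r 0) ulim_normZ normr0 mul0r. Qed.

Definition null_pred : {pred ellinfty X} := fun x => ulim_norm x == 0.

Lemma null_submod_closed : submod_closed null_pred.
Proof.
split=> [|a x y]; first exact/eqP/ulim_norm0.
move=> /eqP x0 /eqP y0; change (ulim_norm (a *: x + y) == 0).
rewrite eq_le ulim_norm_ge0 andbT (le_trans (ulim_normD _ _))//.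
by rewrite ulim_normZ x0 y0 mulr0 addr0.
Qed.

HB.instance Definition _ :=
  GRing.isSubmodClosed.Build R (ellinfty X) null_pred null_submod_closed.

Definition ultrapower := Quotient.quot null_pred.
HB.instance Definition _ := EqQuotient.on ultrapower.
HB.instance Definition _ := GRing.Zmodule.on ultrapower.
HB.instance Definition _ := ZmodQuotient.on ultrapower.

Lemma ultrapower_eqP x y :
  reflect (ulim_norm (x - y) = 0) (x == y %[mod ultrapower]).
Proof. by rewrite -Quotient.idealrBE; exact: eqP. Qed.

Definition ultrapower_scale (a : R) (z : ultrapower) : ultrapower :=
  \pi_ultrapower (a *: repr z).

Lemma pi_ultrapower_scale (a : R) x :
  ultrapower_scale a (\pi_ultrapower x) = \pi_ultrapower (a *: x).
Proof.
apply/eqP/ultrapower_eqP; rewrite -scalerBr ulim_normZ.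
suff -> : ulim_norm (repr (\pi_ultrapower x) - x) = 0 by rewrite mulr0.
by apply/ultrapower_eqP; rewrite reprK.
Qed.

Lemma ultrapower_scaleA (a b : R) (z : ultrapower) :
  ultrapower_scale a (ultrapower_scale b z) = ultrapower_scale (a * b) z.
Proof.
rewrite -[z]reprK; move: (repr z) => x.
by rewrite (pi_ultrapower_scale b) !pi_ultrapower_scale scalerA.
Qed.

Lemma ultrapower_scale1 : left_id 1 ultrapower_scale.
Proof. by move=> z; rewrite -[z]reprK; move: (repr z) => x; rewrite pi_ultrapower_scale scale1r. Qed.

Lemma ultrapower_scaleDr : right_distributive ultrapower_scale +%R.
Proof.
move=> a z w; rewrite -[z]reprK -[w]reprK; move: (repr z) (repr w) => x y.
by rewrite -raddfD !pi_ultrapower_scale scalerDr raddfD.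
Qed.

Lemma ultrapower_scaleDl (z : ultrapower) :
  {morph ultrapower_scale^~ z : a b / a + b}.
Proof.
move=> a b; rewrite -[z]reprK; move: (repr z) => x.
by rewrite !pi_ultrapower_scale scalerDl raddfD.
Qed.

HB.instance Definition _ := GRing.Zmodule_isLmodule.Build R ultrapower
  ultrapower_scaleA ultrapower_scale1 ultrapower_scaleDr ultrapower_scaleDl.

Definition ultrapower_norm (z : ultrapower) : R := ulim_norm (repr z).

Lemma ulim_norm_eq x y : ulim_norm (x - y) = 0 -> ulim_norm x = ulim_norm y.
Proof.
move=> xy0; apply/eqP; rewrite eq_le; apply/andP; split.
  by rewrite -[x](subrK y) (le_trans (ulim_normD _ _))// xy0 add0r.
rewrite -[y](subrK x) (le_trans (ulim_normD _ _))//.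
by rewrite -opprB -scaleN1r ulim_normZ xy0 mulr0 add0r.
Qed.

Lemma pi_ultrapower_norm x :
  ultrapower_norm (\pi_ultrapower x) = ulim_norm x.
Proof. by apply: ulim_norm_eq; apply/ultrapower_eqP; rewrite reprK. Qed.

Lemma ultrapower_normD (z w : ultrapower) :
  ultrapower_norm (z + w) <= ultrapower_norm z + ultrapower_norm w.
Proof.
rewrite -[z]reprK -[w]reprK; move: (repr z) (repr w) => x y.
by rewrite -raddfD !pi_ultrapower_norm ulim_normD.
Qed.

Lemma ultrapower_normZ (a : R) (z : ultrapower) :
  ultrapower_norm (a *: z) = `|a| * ultrapower_norm z.
Proof.
rewrite -[z]reprK; move: (repr z) => x.
by rewrite [_ *: _]pi_ultrapower_scale !pi_ultrapower_norm ulim_normZ.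
Qed.

Lemma ultrapower_norm0_eq0 (z : ultrapower) : ultrapower_norm z = 0 -> z = 0.
Proof.
rewrite -[z]reprK; move: (repr z) => x; rewrite pi_ultrapower_norm => x0.
rewrite -[RHS](raddf0 \pi_ultrapower).
by apply/eqP/ultrapower_eqP; rewrite subr0.
Qed.

HB.instance Definition _ := Lmodule_isNormed.Build R ultrapower
  ultrapower_normD ultrapower_normZ ultrapower_norm0_eq0.

Lemma norm_ultrapowerE x :
  `|\pi_ultrapower x| = lim ((fun n => `|val x n|) @ U).
Proof. exact: pi_ultrapower_norm. Qed.

End ultrapower.
Arguments ultrapower {R} X {U} UU.

(* Main.v *)
Require Import Defs.
From mathcomp Require Import all_boot all_order all_algebra.
From mathcomp Require Import all_classical all_reals all_analysis.
From mathcomp Require Import ring lra.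

Import Order.TTheory GRing.Theory Num.Theory.
Import numFieldNormedType.Exports.

Local Open Scope classical_set_scope.
Local Open Scope ring_scope.

(** Octahedrality of a normed space V is a statement about finite families of
vectors in disguise: V is octahedral iff every finite family s is
[almost_additive], that is, for every e > 0 some unit vector y satisfies
|x + y| >= |x| + 1 - e for all x in s ([octahedral_seqP]).  One direction
takes the span of s.  For the other, a single y that works for a fine finite
net of the unit ball of a finite-dimensional subspace E works for the unit
vectors of E up to a small loss, and an estimate for |u + y| with |u| = 1
propagates to the whole ray through u ([norm_ray_add]).  In the same way V is
locally octahedral iff every pair x, - x is almost additive
([locally_octahedral_seqP]).

In this form both conditions pass between X and its ultrapower, for every
single family s.

Upwards ([almost_additive_lift]): given finitely many bounded sequences, pick
for each index n a unit vector y_n that is almost additive, with error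
1/(n+1), to their n-th terms.  The ultrafilter is free, so the errors vanish
along it, and the class of (y_n) attains |z + y| = |z| + 1 exactly.  On unit
vectors z this is the equality |z + y| = 2 of the second conditions.

Downwards ([almost_additive_descend]): if y in the ultrapower is almost
additive to finitely many constant sequences, the finitely many strict
inequalities involved hold at ultrafilter-many indices n, hence at some n
simultaneously, and the n-th term of a representative of y, normalized, is
almost additive to the original vectors.

It remains to pass from the exact equalities on unit vectors to almost
additivity of arbitrary vectors inside the ultrapower, which is again
[norm_ray_add], now without error. *)

(** * Total boundedness in finite dimension *)

Lemma interval_net (R : realType) (K e : R) : 0 < e ->
  exists s : seq R, forall c, `|c| <= K -> exists2 d, d \in s & `|c - d| <= e.
Proof.
move=> e0; pose N := Num.trunc ((K + K) / e).
exists [seq n%:R * e - K | n <- iota 0 N.+1] => c; rewrite ler_norml => /andP[Kc cK].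
pose n := Num.trunc ((c + K) / e).
exists (n%:R * e - K).
  apply/mapP; exists n => //; rewrite mem_iota add0n ltnS.
  by apply: le_truncn; rewrite ler_pM2r ?invr_gt0// lerD2r.
have /truncn_itv/andP[] : 0 <= (c + K) / e by apply: divr_ge0; lra.
rewrite -/n ler_pdivlMr// ltr_pdivrMr// -natr1 => lo hi.
by rewrite ler_norml; apply/andP; split; lra.
Qed.

Section banach_space.
Context {R : realType} {V : normedModType R}.
Implicit Types (u v x y : V) (s : seq V) (A : set V).

Definition totally_bounded_balls A := forall r e : R, 0 < e ->
  exists s, forall x, A x -> `|x| <= r -> exists2 v, v \in s & `|x - v| <= e.

(** Adding one generator b to A keeps bounded parts totally bounded.  If b has
positive distance d to A, a bound on c *: b + x bounds |c| by r / d and hence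
x, and a product of a net of scalars with a net of A does the job.  If the
distance is 0, vectors of A approximate c *: b + x, and a net of a slightly
larger ball of A suffices.  In this
second case the coefficient c may be unbounded, which is why the two cases
have to be told apart. *)
Lemma totally_bounded_balls_add_line A b :
    (forall (c : R) x, A x -> A (c *: x)) ->
    (forall x y, A x -> A y -> A (x + y)) ->
  totally_bounded_balls A ->
  totally_bounded_balls [set c *: b + x | c in [set: R] & x in A].
Proof.
move=> Ascale Aadd Atb r e e0.
have [[d d0 Ad]|near_b] :=
    pselect (exists2 d : R, 0 < d & forall x, A x -> d <= `|b - x|).
- have [t tP] := Atb (r + r / d * `|b|) (e / 2) (divr_gt0 e0 (ltr0Sn _ _)).
  (* |b| + 1 instead of |b|, as b may be 0; likewise |c| + 1 below *)
  have [|l lP] := @interval_net R (r / d) (e / (2 * (`|b| + 1))).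
    by apply: divr_gt0 => //; have := normr_ge0 b; lra.
  exists [seq c *: b + x | c <- l, x <- t] => _ [c _ [x Ax <-]] bound.
  have cr : `|c| <= r / d.
    rewrite ler_pdivlMr//; apply: le_trans bound.
    have [->|c0] := eqVneq c 0; first by rewrite normr0 mul0r.
    have -> : c *: b + x = c *: (b - (- c^-1) *: x).
      by rewrite scalerBr scalerA mulrN divff// scaleN1r opprK.
    by rewrite normrZ ler_wpM2l//; apply: Ad; exact: Ascale.
  have [c' c'l cc'] := lP _ cr.
  have [|x' x't xx'] := tP x Ax.
    have -> : x = (c *: b + x) - c *: b by rewrite addrAC subrr add0r.
    apply: le_trans (ler_normB _ _) _; rewrite lerD// normrZ.
    by rewrite ler_wpM2r.
  exists (c' *: b + x'); first by apply/allpairsP; exists (c', x').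
  rewrite opprD addrACA -scalerBl (le_trans (ler_normD _ _))// normrZ.
  have cb : `|c - c'| * `|b| <= e / 2.
    apply: (@le_trans _ _ (e / (2 * (`|b| + 1)) * (`|b| + 1))).
      apply: ler_pM => //; lra.
    have b1 : `|b| + 1 != 0 by rewrite gt_eqF//; have := normr_ge0 b; lra.
    have -> // : e / (2 * (`|b| + 1)) * (`|b| + 1) = e / 2 by field.
  lra.
have [t tP] := Atb (r + e / 2) (e / 2) (divr_gt0 e0 (ltr0Sn _ _)).
exists t => _ [c _ [x Ax <-]] bound.
have c1 : 0 < `|c| + 1 by have := normr_ge0 c; lra.
have [a Aa ab] : exists2 a, A a & `|b - a| < e / (2 * (`|c| + 1)).
  apply: contrapT => far; apply: near_b; exists (e / (2 * (`|c| + 1))).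
    by apply: divr_gt0 => //; lra.
  by move=> a Aa; rewrite leNgt; apply/negP => ab; apply: far; exists a.
have cba : `|(c *: b + x) - (c *: a + x)| <= e / 2.
  rewrite opprD addrACA subrr addr0 -scalerBr normrZ.
  apply: (@le_trans _ _ ((`|c| + 1) * (e / (2 * (`|c| + 1))))).
    by apply: ler_pM => //; [lra | exact: ltW].
  have c1' := lt0r_neq0 c1.
  by have -> // : (`|c| + 1) * (e / (2 * (`|c| + 1))) = e / 2 by field.
have [||v vt vx] := tP (c *: a + x); first by apply: Aadd => //; exact: Ascale.
  have := le_trans (ler_dist_dist (c *: b + x) (c *: a + x)) cba.
  by rewrite ler_norml => /andP[]; lra.
exists v => //.
have := ler_distD (c *: a + x) (c *: b + x) v; lra.
Qed.

Lemma totally_bounded_balls_findim (E : set V) :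
  findim_subspace E -> totally_bounded_balls E.
Proof.
case=> k [b ->] {E}; elim: k => [|k IH] in b *.
  move=> r e e0; exists [:: 0] => _ [c ->] _; exists 0; first exact: mem_head.
  by rewrite big_ord0 subr0 normr0 ltW.
set A := [set x | exists c : 'I_k -> R, x = \sum_i c i *: b (lift ord0 i)].
have -> : [set x | exists c : 'I_k.+1 -> R, x = \sum_i c i *: b i] =
    [set c *: b ord0 + x | c in [set: R] & x in A].
  apply/seteqP; split=> x /=.
    case=> c ->; exists (c ord0) => //.
    exists (\sum_i c (lift ord0 i) *: b (lift ord0 i)).
      by exists (fun i => c (lift ord0 i)).
    by rewrite big_ord_recl.
  case=> c _ [_ [a ->] <-].
  exists (fun i => if unlift ord0 i is Some j then a j else c).
  rewrite big_ord_recl unlift_none; congr (_ + _).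
  by apply: eq_bigr => i _; rewrite liftK.
apply: totally_bounded_balls_add_line; last exact: IH.
- move=> c _ [a ->]; exists (fun i => c * a i).
  by rewrite scaler_sumr; apply: eq_bigr => i _; rewrite scalerA.
- move=> _ _ [a ->] [a' ->]; exists (fun i => a i + a' i).
  by rewrite -big_split; apply: eq_bigr => i _; rewrite /= scalerDl.
Qed.

(** * Octahedrality through finite families *)

(** The additive error e is interchangeable with the relative error
(1 - e) * (`|x| + 1) on a single bounded family; it is the form that
survives perturbation of x and y without case distinctions on the size of e.
*)
Definition almost_additive s := forall e : R, 0 < e ->
  exists2 y, unit_sphere V y & forall x, x \in s -> `|x| + 1 - e <= `|x + y|.

(** Almost additivity at one unit vector spreads along its ray with the same
relative error: for t <= 1 go from t *: u + y to u + y by adding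
(1 - t) *: u, for t >= 1 go from t *: u + y to t *: (u + y) by adding
(t - 1) *: y, and use the triangle inequality. *)
Lemma norm_ray_add u y (d t : R) :
    `|u| = 1 -> `|y| = 1 -> 0 <= d -> 0 <= t -> 2 - d <= `|u + y| ->
  (1 - d) * (t + 1) <= `|t *: u + y|.
Proof.
move=> u1 y1 d0 t0 uy.
have [t1|/ltW t1] := leP t 1.
  have -> : t *: u + y = (u + y) - (1 - t) *: u.
    by rewrite scalerBl scale1r opprB [RHS]addrC addrA subrK.
  apply: le_trans (lerB_dist _ _).
  rewrite normrZ u1 ger0_norm; last by lra.
  have := mulr_ge0 d0 t0; nra.
have -> : t *: u + y = t *: (u + y) - (t - 1) *: y.
  by rewrite scalerBl scale1r scalerDr opprB -addrA [t *: y + _]addrC subrK.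
apply: le_trans (lerB_dist _ _).
rewrite !normrZ y1 !ger0_norm//; last by lra.
have := ler_wpM2l t0 uy; nra.
Qed.

(** Nontriviality of the space provides the direction of the zero vector, which
is thereby treated like any other vector. *)
Lemma unit_direction x : (exists w : V, w != 0) ->
  exists2 u, `|u| = 1 & x = `|x| *: u.
Proof.
case=> w w0; have [->|x0] := eqVneq x 0.
  by exists (`|w|^-1 *: w); [exact: normfZV | rewrite normr0 scale0r].
exists (`|x|^-1 *: x); first exact: normfZV.
by rewrite scalerA divff ?normr_eq0// scale1r.
Qed.

Lemma unit_neq0 y : unit_sphere V y -> exists w : V, w != 0.
Proof.
by move=> y1; exists y; rewrite -normr_eq0 y1 oner_eq0.
Qed.

Lemma almost_additive_of_relative s (M : R) : 0 < M ->
    (forall x, x \in s -> `|x| + 1 <= M) ->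
    (forall e : R, 0 < e -> exists2 y, unit_sphere V y &
      forall x, x \in s -> (1 - e) * (`|x| + 1) <= `|x + y|) ->
  almost_additive s.
Proof.
move=> M0 sM sP e e0; have [y y1 yP] := sP (e / M) (divr_gt0 e0 M0).
exists y => // x xs; apply: le_trans (yP _ xs).
rewrite mulrBl mul1r lerB//.
by rewrite mulrAC ler_pdivrMr// ler_wpM2l ?(ltW e0)// sM.
Qed.

Lemma octahedral_seqP : octahedral V <-> forall s, almost_additive s.
Proof.
split=> [oct s|all_s E e Efin e0].
  have norm_s x : x \in s -> `|x| <= \sum_(v <- s) `|v|.
    by move=> xs; rewrite (big_rem x)//= lerDl sumr_ge0.
  apply: (@almost_additive_of_relative _ (\sum_(v <- s) `|v| + 1)).
  - by rewrite ltr_wpDl// sumr_ge0.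
  - by move=> x /norm_s; rewrite lerD2r.
  move=> e e0; pose b (i : 'I_(size s)) := s`_i.
  have [|y y1 yP] := oct [set x | exists c : 'I_(size s) -> R,
      x = \sum_i c i *: b i] e _ e0; first by exists (size s), b.
  exists y => // x /(nthP 0)[i ilt <-]; apply: yP.
  exists (fun j => (j == Ordinal ilt)%:R).
  rewrite (bigD1 (Ordinal ilt))//= eqxx scale1r big1 ?addr0// => j /negbTE ->.
  by rewrite scale0r.
(* the three thirds: replacing |v| by |u|, replacing |v + y| by |u + y|, and the
   error of y on the net *)
have e3 : 0 < e / 3 by lra.
have [s sP] := @totally_bounded_balls_findim E Efin 1 _ e3.
have [y y1 yP] := all_s s _ e3; exists y => // x Ex.
have [u u1 xu] := unit_direction x (unit_neq0 _ y1).
have [x0|x0] := eqVneq x 0.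
  rewrite x0 normr0 !add0r mulr1 y1; lra.
rewrite {2}xu; apply: norm_ray_add => //; first exact: ltW.
have Eu : E u.
  have -> : u = `|x|^-1 *: x by rewrite {2}xu scalerA mulVf ?normr_eq0// scale1r.
  case: Efin Ex => k [b -> [c ->]]; exists (fun i => `|\sum_i c i *: b i|^-1 * c i).
  by rewrite scaler_sumr; apply: eq_bigr => i _; rewrite scalerA.
have [|v vs uv] := sP u Eu; first by rewrite u1.
have := yP _ vs.
have : `|u| - `|v| <= `|u - v| by exact: lerB_dist.
have : `|v + y| - `|u + y| <= `|u - v|.
  by rewrite distrC; apply: le_trans (lerB_dist _ _) _;
    rewrite opprD addrACA subrr addr0.
rewrite u1; lra.
Qed.

Lemma locally_octahedral_seqP :
  locally_octahedral V <-> forall x, almost_additive [:: x; - x].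
Proof.
split=> [oct x|all_x x e e0].
  apply: (@almost_additive_of_relative _ (`|x| + 1)).
  - by rewrite ltr_wpDl.
  - by move=> y; rewrite !inE => /orP[]/eqP->; rewrite ?normrN.
  move=> e e0; have [y y1 yP] := oct x e e0; exists y => // v.
  rewrite !inE => /orP[]/eqP->.
    by have := yP 1; rewrite normr1 mul1r scale1r.
  by have := yP (-1); rewrite normrN1 mul1r scaleN1r normrN.
have X0 : exists w : V, w != 0.
  by have [y /unit_neq0] := all_x x 1 ltr01.
have [u u1 xu] := unit_direction x X0.
have [y y1 yP] := all_x u e e0; exists y => // r.
rewrite -normrZ; set z := r *: x.
(* r *: x points in the direction of u or of - u according to the sign of r *)
have [w w1 [wu zw]] : exists2 w, `|w| = 1 & w \in [:: u; - u] /\ z = `|z| *: w.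
  have zu : z = (r * `|x|) *: u by rewrite /z {1}xu scalerA.
  have nz : `|z| = `|r * `|x| | by rewrite zu normrZ u1 mulr1.
  have [rx|/ltW rx] := leP 0 (r * `|x|).
    by exists u => //; rewrite mem_head nz ger0_norm.
  exists (- u); first by rewrite normrN.
  by rewrite !inE eqxx orbT nz ler0_norm// scaleNr scalerN opprK.
rewrite {2}zw; apply: norm_ray_add => //; first exact: ltW.
by have := yP _ wu; rewrite w1 -[1 + 1]/(2%:R).
Qed.

End banach_space.

(** * Transfer between a space and its ultrapower *)

Section ultrapower.
Context {R : realType} {X : normedModType R} {U : set_system nat}.
Context {UU : UltraFilter U}.
Local Notation XU := (ultrapower X UU).
Local Notation pi := (\pi_XU%qT).

Lemma ultrapower_piD (x y : ellinfty X) : pi (x + y) = pi x + pi y.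
Proof. exact: raddfD. Qed.

Lemma ultrapower_piN (x : ellinfty X) : pi (- x) = - pi x.
Proof. exact: raddfN. Qed.

Lemma free_filter_cofinite : free_filter U -> U --> \oo.
Proof.
move=> U_free.
have Un (n : nat) : \forall m \near U, m != n.
  have : ~ (\bigcap_(A in U) A) n by rewrite U_free.
  move=> /existsNP[A /not_implyP[UA An]].
  by apply: filterS UA => m Am; apply/eqP => mn; apply: An; rewrite -mn.
have Uge (n : nat) : \forall m \near U, (n <= m)%N.
  elim: n => [|n IH]; first exact: nearW.
  by apply: filterS2 IH (Un n) => m nm mn; rewrite ltn_neqAle eq_sym mn.
by move=> A [n _ nA]; apply: filterS (Uge n) => m /nA.
Qed.

Lemma ultrapower_norm_cvg (x : ellinfty X) :
  (fun n => `|val x n|) @ U --> `|pi x|.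
Proof. by rewrite norm_ultrapowerE; exact: ulim_normP. Qed.

Definition ellinfty_of_bounded (x : nat -> X) (M : R)
  (xM : forall n, `|x n| <= M) : ellinfty X :=
  exist _ x (introT (ellinfty_predP x) (ex_intro _ M xM)).

Definition diagonal (x : X) : ellinfty X :=
  ellinfty_of_bounded (fun=> x) `|x| (fun=> lexx _).

Lemma norm_diagonal x : `|pi (diagonal x)| = `|x|.
Proof. by rewrite norm_ultrapowerE; apply: cvg_lim => //; exact: cvg_cst. Qed.

(** A diagonal choice turns approximation into attainment: the error 1/(n+1) at
the n-th coordinate is invisible in the limit. *)
Lemma almost_additive_lift (s : seq (ellinfty X)) : free_filter U ->
    (forall n, almost_additive [seq val x n | x <- s]) ->
  exists2 z : XU, unit_sphere XU z &
    forall x, x \in s -> `|pi x + z| = `|pi x| + 1.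
Proof.
move=> U_free sP.
have /choice[y yP] : forall n, exists y : X, `|y| = 1 /\
    forall x, x \in s -> `|val x n| + 1 - harmonic n <= `|val x n + y|.
  move=> n; have [|y y1 yP] := sP n (harmonic n); first by rewrite /= invr_gt0.
  by exists y; split=> // x xs; apply: yP; exact: map_f.
have y1 n : `|y n| <= 1 by have [->] := yP n.
have z1 : `|pi (ellinfty_of_bounded y 1 y1)| = 1.
  rewrite norm_ultrapowerE; apply: cvg_lim => //=.
  under eq_cvg do rewrite (yP _).1.
  exact: cvg_cst.
exists (pi (ellinfty_of_bounded y 1 y1)) => // x xs.
apply/eqP; rewrite eq_le; apply/andP; split.
  by apply: le_trans (ler_normD _ _) _; rewrite z1.
have harm0 : @harmonic R @ U --> (0 : R).
  exact: cvg_trans (cvg_app _ (free_filter_cofinite U_free)) cvg_harmonic.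
have lo : `|val x n| + 1 - harmonic n @[n --> U] --> `|pi x| + 1.
  rewrite -[X in _ --> X]subr0; apply: cvgB harm0.
  by apply: cvgD (ultrapower_norm_cvg x) _; exact: cvg_cst.
have hi := ultrapower_norm_cvg (x + ellinfty_of_bounded y 1 y1).
rewrite ultrapower_piD in hi; apply: (ler_cvg_to lo hi).
by apply: nearW => n; exact: (yP n).2.
Qed.

Lemma near_all_in (T : eqType) (s : seq T) (P : T -> nat -> Prop) :
  (forall x, x \in s -> \forall n \near U, P x n) ->
  \forall n \near U, forall x, x \in s -> P x n.
Proof.
elim: s => [_|a s IH sP]; first exact: nearW.
have Pa := sP a (mem_head _ _).
have Ps : \forall n \near U, forall x, x \in s -> P x n.
  by apply: IH => x xs; apply: sP; rewrite inE xs orbT.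
apply: filterS2 Pa Ps => n Pan Psn x.
by rewrite inE => /orP[/eqP->|/Psn].
Qed.

(** Only finitely many strict inequalities on limits are involved, so some index
satisfies them all.  The n-th term found this way has norm close to 1 but not
equal to it; normalizing costs another third of e. *)
Lemma almost_additive_descend (s : seq X) :
  almost_additive [seq pi (diagonal x) : XU | x <- s] -> almost_additive s.
Proof.
move=> sP e e0; have e3 : 0 < e / 3 by lra.
have [z z1 zP] := sP _ e3.
pose y := repr z; have zy : pi y = z by exact: reprK.
have y1 : (fun n => `|val y n|) @ U --> (1 : R).
  by rewrite -z1 -zy; exact: ultrapower_norm_cvg.
have far : \forall n \near U, forall x, x \in s ->
    `|x| + 1 - e / 3 - e / 3 < `|x + val y n|.
  apply: near_all_in => x xs.
  apply: (cvgr_gt _ (ultrapower_norm_cvg (diagonal x + y))).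
  rewrite ultrapower_piD zy; apply: lt_le_trans (zP _ (map_f _ xs)).
  by rewrite norm_diagonal; lra.
have close : \forall n \near U, `|1 - `|val y n| | < e / 3.
  by move/cvgrPdist_lt: y1; apply.
have pos : \forall n \near U, 0 < `|val y n| by exact: cvgr_gt y1 _ ltr01.
have [n [[farn closen] posn]] := filter_ex (filterI (filterI far close) pos).
have yn0 : val y n != 0 by rewrite -normr_gt0.
exists (`|val y n|^-1 *: val y n); first exact: normfZV.
move=> x /farn; set v := val y n in farn closen posn yn0 *.
have : `|v - `|v|^-1 *: v| < e / 3.
  rewrite -[X in X - _]scale1r -scalerBl normrZ -{2}[`|v|]normr_id -normrM.
  by rewrite mulrBl mul1r mulVf ?gt_eqF// distrC.
have : `|x + v| <= `|x + `|v|^-1 *: v| + `|v - `|v|^-1 *: v|.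
  by apply: le_trans (ler_normD _ _); rewrite -addrA [_ *: v + _]addrC subrK.
lra.
Qed.

End ultrapower.

Theorem proposition2p10 (R : realType) (X : completeNormedModType R)
    (X_nontrivial : exists x : X, x != 0)
    (U : set_system nat) (UU : UltraFilter U) (U_free : free_filter U) :
  [<-> octahedral X;
       forall (n : nat) (z_ : 'I_n -> ultrapower X UU), (0 < n)%N ->
         (forall i, unit_sphere (ultrapower X UU) (z_ i)) ->
         exists2 z, unit_sphere (ultrapower X UU) z &
           forall i, `|z_ i + z| = 2;
       octahedral (ultrapower X UU)] /\
  [<-> locally_octahedral X;
       forall z, unit_sphere (ultrapower X UU) z ->
         exists2 w, unit_sphere (ultrapower X UU) w &
           `|z + w| = 2 /\ `|z - w| = 2;
       locally_octahedral (ultrapower X UU)].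
Proof.
have XU0 : exists w : ultrapower X UU, w != 0.
  have [x x0] := X_nontrivial; exists (\pi_(ultrapower X UU)%qT (diagonal x)).
  by rewrite -normr_eq0 norm_diagonal normr_eq0.
have ray (v u z : ultrapower X UU) : `|u| = 1 -> `|z| = 1 -> v = `|v| *: u ->
    `|u + z| = 2 -> `|v| + 1 <= `|v + z|.
  move=> u1 z1 vu uz; rewrite {2}vu -[leLHS]mul1r -[X in X * _]subr0.
  by apply: norm_ray_add => //; rewrite uz subr0.
split; tfae.
- move=> /octahedral_seqP oct n z_ _ z1.
  have [z z1' zP] := almost_additive_lift [seq repr (z_ i) | i <- enum 'I_n] U_free
    (fun n => oct _).
  exists z => // i; have := zP (repr (z_ i)).
  by rewrite reprK z1; apply; apply: map_f; rewrite mem_enum.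
- move=> attain; apply/octahedral_seqP => s e e0.
  have /choice[u uP] : forall v : ultrapower X UU, exists u,
      `|u| = 1 /\ v = `|v| *: u.
    by move=> v; have [u u1 vu] := unit_direction v XU0; exists u.
  (* prepending 0 makes the family nonempty even if s is empty *)
  have [||z z1 zP] := attain (size s).+1 (fun i => u (0 :: s)`_i) => //.
    by move=> i; exact: (uP _).1.
  exists z => // v vs; apply: (@le_trans _ _ (`|v| + 1)); first lra.
  have [u1 vu] := uP v; apply: (ray v (u v)) => //.
  have vlt : (index v (0%R :: s) < (size s).+1)%N.
    by rewrite index_mem inE vs orbT.
  by have := zP (Ordinal vlt); rewrite nth_index// inE vs orbT.
- move=> /octahedral_seqP oct; apply/octahedral_seqP => s.
  exact: almost_additive_descend (oct _).
- move=> /locally_octahedral_seqP oct z z1.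
  have [n|w w1 wP] := almost_additive_lift [:: repr z; - repr z] U_free.
    exact: oct (val (repr z) n).
  have zE : \pi_(ultrapower X UU)%qT (repr z) = z by exact: reprK.
  exists w => //; split.
    by have := wP (repr z); rewrite zE z1; apply; rewrite inE eqxx.
  rewrite -normrN opprB addrC.
  have := wP (- repr z); rewrite ultrapower_piN zE normrN z1; apply.
  by rewrite !inE eqxx orbT.
- move=> attain; apply/locally_octahedral_seqP => v e e0.
  have [u u1 vu] := unit_direction v XU0.
  have [w w1 [uw1 uw2]] := attain u u1; exists w => // x.
  have le_e (a : R) : a - e <= a by lra.
  rewrite !inE => /orP[]/eqP->; apply: le_trans (le_e _) _.
    exact: (ray v u).
  apply: (ray (- v) (- u)) => //; rewrite ?normrN//.
    by rewrite scalerN -vu.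
  by rewrite -normrN opprD opprK.
- move=> /locally_octahedral_seqP oct; apply/locally_octahedral_seqP => x.
  apply: almost_additive_descend.
  suff <- : [:: \pi_(ultrapower X UU)%qT (diagonal x);
      - \pi_(ultrapower X UU)%qT (diagonal x)] =
      [seq \pi_(ultrapower X UU)%qT (diagonal y) | y <- [:: x; - x]].
    exact: oct.
  rewrite /= -ultrapower_piN; congr [:: _; \pi_(ultrapower X UU)%qT _].
  exact: val_inj.
Qed.
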